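(* Let $D\ge 1$ and $r\ge 3$ be integers. For the Hamming graph $H(D,r)$, the matrix $\mathbb{A}_{D}^{-1}\mathbb{A}_{D}^{*-1}\mathbb{A}_{D}\mathbb{A}_{D}^{*}$ is diagonalizable, with eigenvalues $(1-r)^s$, $-D \leq s \leq D$.
   Context: Let $X$ be a set with $|X|=r$. The Hamming graph $H(D,r)$ has vertex set $\mathbb{X}=X\times\cdots\times X$ ($D$ factors), with two vertices adjacent whenever they differ in precisely one coordinate; it is distance-regular with diameter $D$. Let $\partial$ denote its path-length distance. Matrices are complex, with rows and columns indexed by $\mathbb{X}$. For $0\le i\le D$ the $i$th distance matrix $\mathbb{A}_i$ has $(y,z)$-entry $1$ if $\partial(y,z)=i$ and $0$ otherwise. The primitive idempotents $\mathbb{E}_0,\ldots,\mathbb{E}_D$ are taken in the standard $Q$-polynomial ordering: $\mathbb{E}_i$ is the matrix of the orthogonal projection of $\mathbb{C}^{\mathbb{X}}$ onto the eigenspace of $\mathbb{A}_1$ with eigenvalue $(r-1)D-ri$. Fix $x\in X$ and let $\mathbf{x}=(x,x,\ldots,x)\in\mathbb{X}$. For $0\le i\le D$ the $i$th dual distance matrix $\mathbb{A}_i^*$ (with respect to $\mathbf{x}$) is the diagonal matrix with $(y,y)$-entry $r^D(\mathbb{E}_i)_{\mathbf{x}y}$ for $y\in\mathbb{X}$. It is known that $\mathbb{A}_D$ and $\mathbb{A}_D^*$ are invertible. *)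

(* Defs.v *)
From HB Require Import structures.
From mathcomp Require Import all_boot all_order all_algebra.
From mathcomp Require Import spectral reals complex.

Set Implicit Arguments.
Unset Strict Implicit.
Unset Printing Implicit Defensive.

Import Order.TTheory GRing.Theory Num.Theory.
Local Open Scope ring_scope.

(* Path-length distance in the graph with adjacency relation e: the least
   length of an e-walk from y to z. A shortest walk has length < #|T|, hence
   the bound on the search; the junk value #|T| means "not connected". *)
Definition gdist (T : finType) (e : rel T) (y z : T) : nat :=
  find (fun n => [exists p : n.-tuple T, path e y p && (last y p == z)])
       (iota 0 #|T|).

(* Matrices indexed by a finite type T are 'M_#|T|, an element y : T being
   identified with its index enum_rank y. *)
Definition distmx (C : pzRingType) (T : finType) (e : rel T) (i : nat)
    : 'M[C]_#|T| :=
  \matrix_(j, k) (gdist e (enum_val j) (enum_val k) == i)%:R.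

(* Matrix, acting on column vectors, of the orthogonal projection (for the
   standard Hermitian product) onto {v | A v = a v}. The library's eigenspace
   and proj_ortho act on row vectors, whence the two transpositions. *)
Definition eigenproj (C : numClosedFieldType) (n : nat) (A : 'M[C]_n) (a : C)
    : 'M[C]_n :=
  (proj_ortho (eigenspace A^T a))^T.

Section Hamming.
Variables (C : numClosedFieldType) (X : finType) (D : nat).

Definition hvertex : finType := {ffun 'I_D -> X}.

Definition hamming : rel hvertex :=
  [rel y z : hvertex | #|[set k | y k != z k]| == 1%N].

Definition hA (i : nat) : 'M[C]_#|hvertex| := distmx C hamming i.

Definition hE (i : nat) : 'M[C]_#|hvertex| :=
  eigenproj (hA 1) ((#|X|%:R - 1) * D%:R - #|X|%:R * i%:R).

Definition hbase (x : X) : hvertex := [ffun=> x].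

Definition hAstar (x : X) (i : nat) : 'M[C]_#|hvertex| :=
  diag_mx (\row_j (#|X|%:R ^+ D * hE i (enum_rank (hbase x)) j)).

End Hamming.

(* Main.v *)
Require Import Defs.
From mathcomp Require Import all_boot all_order all_algebra.
From mathcomp Require Import spectral reals complex.
From mathcomp Require Import ring zify.
Import Order.TTheory GRing.Theory Num.Theory.
Local Open Scope ring_scope.

Set Implicit Arguments.
Unset Strict Implicit.
Unset Printing Implicit Defensive.

(** Every matrix involved is a D-fold tensor power of an r x r matrix: A_D of
    K = J - 1, E_D of 1 - J/r, and A*_D of the diagonal matrix S with entry r - 1
    at x and -1 elsewhere. Hence the matrix of the theorem is the tensor power of
    N = K^-1 S^-1 K S, and it is enough to diagonalize N. A row vector t with
    t K S = c (t S K) gives the left eigenvector t S K of N for c; such t are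
    e_x with c = 1/(1-r), the all-ones vector with c = 1-r, and, with c = 1, all t
    that vanish at x and have sum zero. The latter exist because r >= 3, so all
    exponents between -D and D occur in the tensor power. *)

(** * Path-length distance in the Hamming graph *)

Section HammingDistance.
Variables (X : finType) (D : nat).
Implicit Types y z w : hvertex X D.

Definition hdist y z : nat := #|[set k | y k != z k]|.

Lemma hdist_triangle y z w : (hdist y w <= hdist y z + hdist z w)%N.
Proof.
rewrite /hdist -cardsUI; apply: leq_trans (leq_addr _ _).
apply: subset_leq_card; apply/subsetP=> k; rewrite !inE.
by case: (y k =P z k) => // ->.
Qed.

Lemma hdist_path y p : path (@hamming X D) y p -> (hdist y (last y p) <= size p)%N.
Proof.
elim: p y => [y _|z p IHp y] /=.
  by rewrite leqn0 cards_eq0; apply/eqP/setP=> k; rewrite !inE eqxx.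
case/andP=> /eqP yz /IHp le_p; apply: leq_trans (hdist_triangle y z _) _.
by rewrite /hdist yz ltnS.
Qed.

(** Induction on the number of differing coordinates: copying one of them from [z] into [y] gives a
    neighbour of [y] one step closer to [z]. *)
Lemma geodesic_exists y z :
  exists p : (hdist y z).-tuple (hvertex X D),
    path (@hamming X D) y p && (last y p == z).
Proof.
move: {2}(hdist y z) (erefl (hdist y z)) => n; elim: n y => [|n IHn] y yz.
  rewrite yz; exists [tuple]; apply/eqP/ffunP=> k /=; apply/eqP/negPn.
  by move/eqP: yz; rewrite cards_eq0 => /eqP/setP/(_ k); rewrite !inE => ->.
have /card_gt0P[k0] : (0 < hdist y z)%N by rewrite yz.
rewrite inE => yz0.
pose y' : hvertex X D := [ffun k => if k == k0 then z k else y k].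
have yy' : hamming y y'.
  apply/cards1P; exists k0; apply/setP=> k.
  by rewrite !inE ffunE; case: (k =P k0) => [->|]; rewrite ?eqxx.
have y'z : hdist y' z = n.
  apply/eqP; rewrite -eqSS -yz /hdist (cardsD1 k0 [set k | y k != z k]).
  rewrite inE yz0 add1n eqSS; apply/eqP; congr #|pred_of_set _|; apply/setP=> k.
  by rewrite !inE ffunE; case: (k =P k0) => [->|]; rewrite ?eqxx.
have [p /andP[path_p last_p]] := IHn _ y'z.
have sz : size (y' :: p) == hdist y z by rewrite /= size_tuple y'z yz.
by exists (Tuple sz); rewrite /= last_p path_p !andbT; exact: yy'.
Qed.

Hypothesis card_X : (1 < #|X|)%N.

Lemma gdist_hamming y z : gdist (@hamming X D) y z = hdist y z.
Proof.
rewrite /gdist; set P := fun n => _; set N := #|_|.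
(* [gdist] only tests lengths below the number of vertices; [D < #|X| ^ D] puts [hdist y z] inside
   that range. *)
have lt_N : (hdist y z < N)%N.
  apply: leq_ltn_trans (_ : D < N)%N.
    by rewrite -[X in (_ <= X)%N]card_ord max_card.
  by rewrite /N card_ffun card_ord ltn_expl.
have Pd : P (hdist y z) by apply/existsP; exact: geodesic_exists.
have le_d : (find P (iota 0 N) <= hdist y z)%N.
  rewrite leqNgt; apply/negP=> /(before_find 0)%N.
  by rewrite nth_iota // add0n Pd.
apply/eqP; rewrite eqn_leq le_d /=.
have hasP : has P (iota 0 N) by rewrite has_find size_iota (leq_ltn_trans le_d).
have := nth_find 0%N hasP; rewrite nth_iota ?(leq_ltn_trans le_d) // add0n.
case/existsP=> p /andP[/hdist_path + /eqP last_p].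
by rewrite last_p size_tuple.
Qed.

End HammingDistance.

(** * Kronecker products of matrices indexed by words *)

Section Tensor.
Variables (C : comUnitRingType) (X : finType) (D : nat).
Implicit Types F G : 'I_D -> 'M[C]_#|X|.

(* Vertices appear only through their matrix indices; coordinates are likewise
   taken as indices of elements of X. *)
Definition hcoord (i : 'I_#|hvertex X D|) (k : 'I_D) : 'I_#|X| :=
  enum_rank ((enum_val i : {ffun 'I_D -> X}) k).

Lemma hcoord_rank (y : {ffun 'I_D -> X}) k :
  hcoord (enum_rank (y : hvertex X D)) k = enum_rank (y k).
Proof. by rewrite /hcoord enum_rankK. Qed.

Lemma hcoord_inj i j : hcoord i =1 hcoord j -> i = j.
Proof.
by move=> ij; apply/enum_val_inj/ffunP=> k; apply/enum_rank_inj/ij.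
Qed.

(** The factors may vary with [k], as they do in the summands of [hA 1] and in its spectral
    projections. *)
Definition tens F : 'M[C]_#|hvertex X D| :=
  \matrix_(i, j) \prod_k F k (hcoord i k) (hcoord j k).

Lemma eq_tens F G : F =1 G -> tens F = tens G.
Proof.
by move=> FG; apply/matrixP=> i j; rewrite !mxE; apply: eq_bigr => k _; rewrite FG.
Qed.

(** Summing over an intermediate vertex amounts to summing over each of its coordinates
    independently, by distributivity. *)
Lemma tensM F G : tens F *m tens G = tens (fun k => F k *m G k).
Proof.
apply/matrixP=> i j; rewrite !mxE (reindex enum_rank) /=; last first.
  exact/onW_bij/enum_rank_bij.
under eq_bigr => y _.
  rewrite !mxE -big_split /=; under eq_bigr do rewrite hcoord_rank.
  over.
under [RHS]eq_bigr => k _.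
  rewrite mxE (reindex enum_rank) /=; last exact/onW_bij/enum_rank_bij.
  over.
by rewrite bigA_distr_bigA.
Qed.

Lemma tens_diag (d : 'I_D -> 'rV[C]_#|X|) :
  tens (fun k => diag_mx (d k)) =
  diag_mx (\row_i \prod_k d k 0 (hcoord i k)).
Proof.
apply/matrixP=> i j; rewrite !mxE; case: (i =P j) => [<-|ij].
  by rewrite mulr1n; apply: eq_bigr => k _; rewrite mxE eqxx.
rewrite mulr0n; apply/eqP.
have [k ij_k] : exists k, hcoord i k != hcoord j k.
  apply/existsP; rewrite -negb_forall; apply/negP=> /forallP eqk; apply: ij.
  by apply: hcoord_inj => k; apply/eqP.
by rewrite (bigD1 k) //= mxE (negPf ij_k) mul0r.
Qed.

Lemma tens1 : tens (fun=> 1%:M) = 1%:M.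
Proof.
transitivity (tens (fun=> diag_mx (const_mx 1))).
  by apply: eq_tens => k; rewrite diag_const_mx.
rewrite tens_diag -diag_const_mx; congr diag_mx; apply/rowP=> i.
by rewrite !mxE big1 // => k _; rewrite mxE.
Qed.

Lemma tensZ (c : 'I_D -> C) F :
  tens (fun k => c k *: F k) = (\prod_k c k) *: tens F.
Proof.
apply/matrixP=> i j; rewrite !mxE -big_split; apply: eq_bigr => k _.
by rewrite !mxE.
Qed.

Lemma tens_sum (I : finType) (F : 'I_D -> I -> 'M[C]_#|X|) :
  tens (fun k => \sum_b F k b) =
  \sum_(f : {ffun 'I_D -> I}) tens (fun k => F k (f k)).
Proof.
apply/matrixP=> i j; rewrite summxE !mxE.
under eq_bigr do rewrite summxE.
by rewrite bigA_distr_bigA; apply: eq_bigr => f _; rewrite mxE.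
Qed.

Lemma trmx_tens F : (tens F)^T = tens (fun k => (F k)^T).
Proof.
by apply/matrixP=> i j; rewrite !mxE; apply: eq_bigr => k _; rewrite mxE.
Qed.

Lemma tens_unit F : (forall k, F k \in unitmx) ->
  tens F \in unitmx /\ invmx (tens F) = tens (fun k => invmx (F k)).
Proof.
move=> uF.
have F1 : tens F *m tens (fun k => invmx (F k)) = 1%:M.
  by rewrite tensM -tens1; apply: eq_tens => k; rewrite mulmxV.
have [uT _] := mulmx1_unit F1; split=> //.
by rewrite -[LHS]mulmx1 -F1 mulKmx.
Qed.

End Tensor.

(** * Characterization of the orthogonal projection onto an eigenspace *)

Section EigenProjection.
Local Open Scope sesquilinear_scope.

(** [proj_ortho] fixes the rows of [P^T], which lie in the eigenspace, and kills those of [1 - P^T],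
    which are orthogonal to it. *)
Lemma eigenproj_unique (C : numClosedFieldType) n (A P : 'M[C]_n) (a : C) :
    P ^t* = P -> A *m P = a *: P ->
    (forall m (V : 'M[C]_(n, m)), A *m V = a *: V -> P *m V = V) ->
  eigenproj A a = P.
Proof.
move=> herP AP fixP; rewrite /eigenproj; set U := eigenspace _ _.
apply: trmx_inj; rewrite trmxK.
have PU : P^T *m proj_ortho U = P^T.
  by rewrite proj_ortho_id //; apply/eigenspaceP; rewrite -trmx_mul AP linearZ.
have QU : (1%:M - P^T) *m proj_ortho U = 0.
  rewrite proj_ortho_0 //; apply/orthomx1P.
  have UA : U *m A^T = a *: U by apply/eigenspaceP; exact: submx_refl.
  have PUT : U *m P^T = U.
    apply: trmx_inj; rewrite trmx_mul trmxK; apply: fixP.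
    by rewrite -[A]trmxK -trmx_mul UA; apply: linearZ.
  have hP : P^T ^t* = P^T by rewrite trmxK; apply: trmx_inj; rewrite map_trmx herP trmxK.
  (* The columns of [P] are themselves eigenvectors, so [fixP] applies to [P] and gives
     idempotence. *)
  have PP : P^T *m P^T = P^T by rewrite -trmx_mul (fixP _ P).
  by rewrite -PUT trmx_mul map_mxM hP mulmxA mulmxBl mul1mx PP subrr mul0mx.
by rewrite -[LHS]mul1mx -[1%:M](subrK P^T) mulmxDl QU PU add0r.
Qed.

End EigenProjection.

(** * Sums and products of indicators *)

Lemma sum_delta (R : pzSemiRingType) (I : finType) (f : I -> R) (b : I) :
  \sum_j f j * (j == b)%:R = f b.
Proof.
rewrite (bigD1 b) //= eqxx mulr1 big1 ?addr0 // => j /negPf ->.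
by rewrite mulr0.
Qed.

Lemma prod_natr_bool (R : comPzSemiRingType) (I : finType) (b : pred I) :
  \prod_i (b i)%:R = [forall i, b i]%:R :> R.
Proof.
case: forallP => [bT|/forallP].
  by rewrite big1 // => i _; rewrite bT.
rewrite negb_forall => /existsP[i /negPf bi].
by rewrite (bigD1 i) //= bi mul0r.
Qed.

(** * The matrices of a single coordinate *)

Section Coordinate.
Variables (C : numFieldType) (n : nat).
Hypothesis n_gt1 : (1 < n)%N.

(** The matrix K of the header. *)
Definition offdiag : 'M[C]_n := const_mx 1 - 1%:M.

Lemma offdiagE i j : offdiag i j = (i != j)%:R.
Proof. by rewrite !mxE; case: eqP => _; rewrite ?subrr ?subr0. Qed.

Let J : 'M[C]_n := const_mx 1.

Let n_neq0 : n%:R != 0 :> C.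
Proof. by rewrite pnatr_eq0 -lt0n ltnW. Qed.

Let n1_neq0 : n%:R - 1 != 0 :> C.
Proof. by rewrite subr_eq0 pnatr_eq1 gtn_eqF. Qed.


(* Spectral projections of offdiag: eigenvalue n - 1 for true, -1 for false. *)
Definition coordproj (b : bool) : 'M[C]_n :=
  if b then n%:R^-1 *: J else 1%:M - n%:R^-1 *: J.

Lemma const_mx1_sqr : J *m J = n%:R *: J.
Proof.
apply/matrixP=> i j; rewrite !mxE.
by under eq_bigr do rewrite !mxE mulr1; rewrite sumr_const card_ord mulr1.
Qed.

Lemma coordproj_sum : \sum_b coordproj b = 1%:M.
Proof. by rewrite big_bool /= addrC subrK. Qed.

Lemma coordproj_tr b : (coordproj b)^T = coordproj b.
Proof. by case: b; rewrite /= ?linearB /= ?trmx1 linearZ /= trmx_const. Qed.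

Lemma mul_offdiag_coordproj b :
  offdiag *m coordproj b = (n%:R * b%:R - 1) *: coordproj b.
Proof.
have JE : J *m (n%:R^-1 *: J) = J.
  by rewrite -scalemxAr const_mx1_sqr scalerA mulVf // scale1r.
case: b => /=; rewrite mulmxBl mul1mx ?mulmxBr JE.
  by rewrite mulr1 scalerBl scale1r scalerA mulfV // scale1r.
by rewrite mulmx1 subrr sub0r mulr0 sub0r scaleN1r.
Qed.

Lemma offdiag_tr : offdiag^T = offdiag.
Proof. by rewrite linearB /= trmx1 trmx_const. Qed.

Lemma offdiag_unit : offdiag \in unitmx.
Proof.
(* The inverse is found from [J *m J = n J]. *)
have : offdiag *m ((n%:R - 1)^-1 *: J - 1%:M) = 1%:M.
  rewrite mulmxBl mul1mx mulmxBr mulmx1 -scalemxAr const_mx1_sqr.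
  apply/matrixP=> i j; rewrite !mxE; field.
  exact: n1_neq0.
by case/mulmx1_unit.
Qed.

Variable i0 : 'I_n.

(** The matrix S of the header, with [i0] the index of x. *)
Definition dualdiag : 'M[C]_n := diag_mx (\row_j (n%:R * (j == i0)%:R - 1)).

Lemma dualdiag_unit : dualdiag \in unitmx.
Proof.
rewrite unitmxE det_diag unitfE; apply/prodf_neq0 => j _; rewrite mxE.
by case: (j =P i0) => _; rewrite ?mulr1 // mulr0 sub0r oppr_eq0 oner_neq0.
Qed.

Variable i1 : 'I_n.
Hypothesis i10 : i1 != i0.

(** The constant c of the header attached to row [a] of [pencilmx] is [1 - n] to this power. *)
Definition eigenexp (a : 'I_n) : int :=
  if a == i0 then -1 else if a == i1 then 1 else 0.

(* The rows are the vectors t of the header, with x = i0. *)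
Definition pencilmx : 'M[C]_n :=
  \matrix_(a, j) if a == i0 then (j == i0)%:R else
                 if a == i1 then 1 else (j == a)%:R - (j == i1)%:R.

(** Let [v] pair to zero with every row. Row [i0] gives [v 0 i0 = 0], the difference rows make [v]
    constant off [i0], and the all-ones row makes that constant zero. *)
Lemma pencilmx_unit : pencilmx \in unitmx.
Proof.
rewrite -unitmx_tr -row_free_unit; apply: inj_row_free => v vT.
have vTE a : \sum_j v 0 j * pencilmx a j = 0.
  transitivity ((v *m pencilmx^T) 0 a); last by rewrite vT mxE.
  by rewrite mxE; apply: eq_bigr => j _; rewrite [_^T _ _]mxE.
have v0 : v 0 i0 = 0.
  rewrite -[RHS](vTE i0) -[LHS](sum_delta (v 0)).
  by apply: eq_bigr => j _; rewrite mxE eqxx.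
have va a : a != i0 -> v 0 a = v 0 i1.
  have [-> //|ai1 ai0] := eqVneq a i1.
  apply/eqP; rewrite -subr_eq0 -(sum_delta (v 0) a) -(sum_delta (v 0) i1) -sumrB.
  rewrite -[X in _ == X](vTE a); apply/eqP; apply: eq_bigr => j _.
  by rewrite mxE (negPf ai0) (negPf ai1) mulrBr.
have v1 : v 0 i1 = 0.
  have /eqP := vTE i1; rewrite (bigD1 i0) //= v0 mul0r add0r.
  rewrite (eq_bigr (fun=> v 0 i1)) => [|j ji0]; last first.
    by rewrite mxE (negPf i10) eqxx mulr1 va.
  rewrite sumr_const -mulr_natr mulf_eq0 => /orP[/eqP //|].
  by rewrite pnatr_eq0 -leqn0 leqNgt => /negP[]; apply/card_gt0P; exists i1.
apply/rowP=> a; rewrite mxE; have [-> //|/va ->] := eqVneq a i0; exact: v1.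
Qed.

(** Right multiplication by [offdiag] replaces each entry by its row sum minus that entry. With the
    row sums of [pencilmx] and [pencilmx *m dualdiag] known, the identity is checked on the three
    kinds of rows. *)
Lemma pencilmxP :
  pencilmx *m offdiag *m dualdiag =
  diag_mx (\row_a (1 - n%:R) ^ eigenexp a) *m (pencilmx *m dualdiag *m offdiag).
Proof.
have q_neq0 : 1 - n%:R != 0 :> C by rewrite -opprB oppr_eq0.
have mulJ (M : 'M[C]_n) a j : (M *m J) a j = \sum_l M a l.
  by rewrite mxE; apply: eq_bigr => l _; rewrite mxE mulr1.
pose rs a : C := if a == i0 then 1 else if a == i1 then n%:R else 0.
have sumd b : \sum_(j < n) (j == b)%:R = 1 :> C.
  by rewrite -[RHS](sum_delta (fun=> 1) b); apply: eq_bigr => j _; rewrite mul1r.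
have rsE a : \sum_l pencilmx a l = rs a.
  under eq_bigr do rewrite mxE.
  rewrite /rs; case: ifP => _; last case: ifP => _.
  - exact: sumd.
  - by rewrite sumr_const card_ord.
  - by rewrite sumrB !sumd subrr.
have rsdE a : \sum_l (pencilmx *m dualdiag) a l = n%:R * pencilmx a i0 - rs a.
  rewrite mul_mx_diag -rsE -(sum_delta (pencilmx a)) mulr_sumr -sumrB.
  by apply: eq_bigr => l _; rewrite !mxE; ring.
have mulK (M : 'M[C]_n) a j : (M *m offdiag) a j = \sum_l M a l - M a j.
  by rewrite mulmxBr mulmx1 -(mulJ _ _ j) mxE [(- M) a j]mxE.
apply/matrixP=> a j; rewrite mul_mx_diag mul_diag_mx [LHS]mxE [RHS]mxE !mulK.
rewrite rsE rsdE mul_mx_diag !mxE /rs /eigenexp.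
have [ai0|ai0] := eqVneq a i0; last have [ai1|ai1] := eqVneq a i1.
- rewrite eqxx exprN1; case: (j == i0) => /=; field; exact: q_neq0.
- by rewrite expr1z; ring.
- by rewrite expr0z [i0 == i1]eq_sym (negPf i10); ring.
Qed.

End Coordinate.

(** * Tensor forms of the Hamming matrices *)

Section HammingMatrices.
Variables (C : numClosedFieldType) (X : finType) (D : nat).
Hypothesis card_X : (1 < #|X|)%N.

Let K : 'M[C]_#|X| := offdiag C #|X|.
Let E : bool -> 'M[C]_#|X| := @coordproj C #|X|.

Lemma hA_tens : hA C X D D = tens (fun=> K).
Proof.
apply/matrixP=> i j; rewrite !mxE gdist_hamming //.
under eq_bigr do rewrite offdiagE.
rewrite prod_natr_bool; congr (nat_of_bool _)%:R.
rewrite /hdist; set S := [set k | _].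
have inS k : (k \in S) = (hcoord i k != hcoord j k).
  by rewrite inE (inj_eq enum_rank_inj).
apply/eqP/forallP=> [cardS k|allS].
  suff /eqP ST : S == setT by rewrite -inS ST inE.
  by rewrite eqEcard subsetT cardsT card_ord cardS leqnn.
have -> : S = setT by apply/setP=> k; rewrite inS allS inE.
by rewrite cardsT card_ord.
Qed.

(** The summand of [k] is the indicator that the set of differing coordinates is exactly [[set k]];
    at most one of these events occurs. *)
Lemma hA1_tens :
  hA C X D 1 = \sum_k tens (fun l => if l == k then K else 1%:M).
Proof.
apply/matrixP=> i j; rewrite !mxE summxE gdist_hamming // /hdist.
set S := [set k | _].
have -> : (#|S| == 1)%N%:R = \sum_k (S == [set k])%:R :> C.
  case: (#|S| =P 1%N) => [/eqP/cards1P[k0 ->]|nS].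
    rewrite (bigD1 k0) //= eqxx big1 ?addr0 // => k kk0.
    by rewrite (inj_eq set1_inj) eq_sym (negPf kk0).
  rewrite big1 // => k _; case: eqP => // Sk.
  by case: nS; rewrite Sk cards1.
apply: eq_bigr => k _; rewrite mxE.
rewrite (eq_bigr (fun l => ((l \in S) == (l == k))%:R)) => [|l _].
  rewrite prod_natr_bool; congr (nat_of_bool _)%:R.
  apply/eqP/forallP=> [-> l|Sk]; first by rewrite inE eqxx.
  by apply/setP=> l; rewrite inE; apply/eqP.
rewrite inE -(inj_eq enum_rank_inj) -/(hcoord i l) -/(hcoord j l).
case: ifP => _; first by rewrite offdiagE eqb_id.
by rewrite mxE eqbF_neg negbK.
Qed.

Lemma hA1_mul_tens (f : 'I_D -> bool) :
  hA C X D 1 *m tens (fun k => E (f k)) =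
  (\sum_k (#|X|%:R * (f k)%:R - 1)) *: tens (fun k => E (f k)).
Proof.
rewrite hA1_tens mulmx_suml scaler_suml; apply: eq_bigr => k _.
(* The scalar of slot [k] is written as a product over all slots, equal to 1 off [k], so that
   [tensZ] applies. *)
rewrite tensM -[X in X *: _](_ : \prod_l
  (if l == k then #|X|%:R * (f l)%:R - 1 else 1) = _); last first.
  by rewrite -big_mkcond big_pred1_eq.
rewrite -tensZ; apply: eq_tens => l; case: ifP => _.
  exact: mul_offdiag_coordproj.
by rewrite mul1mx scale1r.
Qed.

Lemma hA1_tr : (hA C X D 1)^T = hA C X D 1.
Proof.
rewrite hA1_tens linear_sum /=; apply: eq_bigr => k _; rewrite trmx_tens.
by apply: eq_tens => l; case: ifP; rewrite ?offdiag_tr ?trmx1.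
Qed.

Lemma tens_mul_hA1 (f : 'I_D -> bool) :
  tens (fun k => E (f k)) *m hA C X D 1 =
  (\sum_k (#|X|%:R * (f k)%:R - 1)) *: tens (fun k => E (f k)).
Proof.
have trE : (tens (fun k => E (f k)))^T = tens (fun k => E (f k)).
  by rewrite trmx_tens; apply: eq_tens => k; apply: coordproj_tr.
apply: trmx_inj; rewrite trmx_mul linearZ /= trE hA1_tr.
exact: hA1_mul_tens.
Qed.

(** The eigenvalue of index [D] is [-D]. A product of coordinate projections with some [true] has a
    larger eigenvalue, hence kills the eigenspace of [-D]; only the all-[false] product survives
    there. *)
Lemma hE_tens : hE C X D D = tens (fun=> E false).
Proof.
have -> : hE C X D D = eigenproj (hA C X D 1) (- D%:R).
  by congr eigenproj; ring.
apply: eigenproj_unique.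
- rewrite trmx_tens; apply/matrixP=> i j; rewrite !mxE rmorph_prod.
  apply: eq_bigr => k _; rewrite coordproj_tr !mxE /=.
  by rewrite rmorphB rmorphM /= fmorphV !rmorph_nat rmorph1.
- rewrite (hA1_mul_tens (fun=> false)); congr (_ *: _).
  by rewrite sumr_const card_ord mulr0 sub0r mulNrn.
move=> m V AV.
(* The products of coordinate projections sum to 1, and hA 1 acts on them by
   #|X| times the number of true's, minus D. *)
have V0 (f : {ffun 'I_D -> bool}) : f != [ffun=> false] ->
    tens (fun k => E (f k)) *m V = 0.
  move=> f_neq0; apply/eqP.
  have : (\sum_k (#|X|%:R * (f k)%:R - 1) + D%:R) *:
         (tens (fun k => E (f k)) *m V) = 0.
    rewrite scalerDl scalemxAl -tens_mul_hA1 -mulmxA AV.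
    by rewrite -scalemxAr scaleNr addNr.
  rewrite sumrB sumr_const card_ord subrK -mulr_sumr => /eqP.
  rewrite scaler_eq0 mulf_eq0 pnatr_eq0 eqn0Ngt (ltnW card_X) /=.
  rewrite -natr_sum pnatr_eq0 sum_nat_eq0 => /orP[/forallP f0|//].
  case/negP: f_neq0; apply/eqP/ffunP=> k; rewrite ffunE.
  by apply: negbTE; rewrite -eqb0; apply: (implyP (f0 k)).
have /(congr1 (mulmx^~ V)) : tens (fun=> \sum_b E b) = 1%:M :> 'M_#|hvertex X D|.
  by rewrite -tens1; apply: eq_tens => k; apply: coordproj_sum.
rewrite tens_sum mulmx_suml mul1mx (bigD1 [ffun=> false]) //=.
rewrite big1 ?addr0 => [PV|f /V0 //].
by rewrite -[RHS]PV; congr (_ *m _); apply: eq_tens => k; rewrite ffunE.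
Qed.

(** The scalar [#|X| ^ D] is spread as one [#|X|] per coordinate, which clears the denominator of
    [1 - J/r]. *)
Lemma hAstar_tens (x : X) :
  hAstar C D x D = tens (fun=> dualdiag C (enum_rank x)).
Proof.
rewrite /hAstar hE_tens tens_diag; congr diag_mx; apply/rowP=> j; rewrite !mxE.
rewrite -[D in _ ^+ D]card_ord -prodr_const -big_split /=; apply: eq_bigr => k _.
rewrite hcoord_rank !mxE ffunE eq_sym mulrBr mulr1 mulfV //.
by rewrite pnatr_eq0 -lt0n ltnW.
Qed.

End HammingMatrices.

(** * Spectrum from an eigenbasis, and the range of the exponents *)

(** The rows of [W] form a basis of left eigenvectors; a nonzero coordinate of an eigenvector in
    this basis identifies its eigenvalue. *)
Lemma diagonalizable_spectrum (F : fieldType) n (M W : 'M[F]_n) (d : 'rV[F]_n) :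
    W \in unitmx -> W *m M = diag_mx d *m W ->
  diagonalizable M /\ (forall a, eigenvalue M a <-> exists i, a = d 0 i).
Proof.
move=> uW WM; split.
  exists W => //; apply/diagonalizable_forPex; exists d.
  exact/simmxP.
move=> a; split=> [/eigenvalueP[v vM v_neq0]|[i ->]].
  pose u := v *m invmx W.
  have vE : v = u *m W by rewrite mulmxKV.
  have ud : u *m diag_mx d = a *: u.
    apply: (can_inj (mulmxK uW)).
    by rewrite -mulmxA -WM mulmxA -vE vM -scalemxAl -vE.
  have /rV0Pn[i ui] : u != 0.
    by apply: contraNneq v_neq0; rewrite vE => ->; rewrite mul0mx.
  exists i; apply: (mulfI ui); move/rowP/(_ i): ud.
  by rewrite mul_mx_diag [LHS]mxE [RHS]mxE [RHS]mulrC.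
apply/eigenvalueP; exists (row i W).
  by rewrite -row_mul WM row_mul row_diag_mx -scalemxAl -rowE.
apply: contraTneq uW => W0; rewrite -row_free_unit.
apply/negP=> /row_freeP[B] /(congr1 (row i)); rewrite row_mul W0 mul0mx.
by move=> /rowP/(_ i)/eqP; rewrite !mxE eqxx eq_sym oner_eq0.
Qed.

Lemma prod_exprz (F : fieldType) (I : finType) (q : F) (e : I -> int) :
  q != 0 -> \prod_k q ^ e k = q ^ (\sum_k e k).
Proof.
move=> q0; rewrite (big_morph (fun m : int => q ^ m) (id1 := 1) (op1 := *%R)) //.
by move=> m n; rewrite expfzDr.
Qed.

Lemma eigenexp_sum_range D n (i0 i1 : 'I_n) (a : 'I_D -> 'I_n) :
  - D%:Z <= \sum_k eigenexp i0 i1 (a k) <= D%:Z.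
Proof.
rewrite -ler_norml; apply: le_trans (ler_norm_sum _ _ _) _.
have -> : D%:Z = \sum_(k < D) 1 by rewrite sumr_const card_ord natz.
apply: ler_sum => k _.
by rewrite /eigenexp; case: ifP; last case: ifP.
Qed.

(** Use [|s|] coordinates equal to [i1] or [i0], according to the sign of [s], and pad with [i2], of
    exponent 0. Exponents 1 and -1 alone would force the parity of [D]. *)
Lemma eigenexp_sum_surj D n (i0 i1 i2 : 'I_n) (s : int) :
    i1 != i0 -> i2 != i0 -> i2 != i1 -> - D%:Z <= s <= D%:Z ->
  exists a : 'I_D -> 'I_n, \sum_k eigenexp i0 i1 (a k) = s.
Proof.
move=> i10 i20 i21 s_range.
have sD : (`|s| <= D)%N by lia.
have e0 : eigenexp i0 i1 i0 = -1 by rewrite /eigenexp eqxx.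
have e1 : eigenexp i0 i1 i1 = 1 by rewrite /eigenexp (negPf i10) eqxx.
have e2 : eigenexp i0 i1 i2 = 0 by rewrite /eigenexp (negPf i20) (negPf i21).
exists (fun k : 'I_D => if (k < `|s|)%N then (if 0 <= s then i1 else i0) else i2).
pose c : int := if 0 <= s then 1 else -1.
rewrite (eq_bigr (fun k : 'I_D => if (k < `|s|)%N then c else 0)) => [|k _].
  rewrite -big_mkcond /= -(big_ord_widen_cond _ xpredT (fun=> c) sD).
  by rewrite sumr_const card_ord /c; case: ifP; lia.
by rewrite /c; case: ifP => // _; case: ifP.
Qed.

Theorem theorem23 (R : realType) (D r : nat) (X : finType) (x : X)
    (hD : (1 <= D)%N) (hr : (3 <= r)%N) (hX : #|X| = r) :
  let A := hA R[i] X D D in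
  let As := hAstar R[i] D x D in
  let M := invmx A *m invmx As *m A *m As in
  diagonalizable M /\
  (forall a : R[i], eigenvalue M a <->
     exists2 s : int, - D%:Z <= s <= D%:Z & a = (1 - r%:R) ^ s).
Proof.
move=> A As M; subst r.
have card_gt1 : (1 < #|X|)%N by apply: leq_trans hr.
pose i0 := enum_rank x.
have [i1 i10] : exists i1, i1 != i0.
  have /card_gt0P[i1] : (0 < #|~: [set i0]|)%N by rewrite cardsC1 card_ord -subn1 subn_gt0.
  by rewrite !inE; exists i1.
(* The full strength of [3 <= r] enters here: [i2] supplies the exponent 0. *)
have [i2 /andP[i20 i21]] : exists i2, (i2 != i0) && (i2 != i1).
  have /card_gt0P[i2] : (0 < #|~: [set i0; i1]|)%N.
    rewrite cardsCs setCK card_ord cards2 subn_gt0.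
    by apply: leq_ltn_trans hr; case: (i0 != i1).
  by rewrite !inE negb_or; exists i2.
have q_neq0 : 1 - #|X|%:R != 0 :> R[i].
  by rewrite subr_eq0 eq_sym pnatr_eq1 gtn_eqF.
pose K := offdiag R[i] #|X|; pose S := dualdiag R[i] i0.
have uK : K \in unitmx by apply: offdiag_unit.
have uS : S \in unitmx by apply: dualdiag_unit.
pose T := pencilmx R[i] i0 i1.
have uW1 : T *m S *m K \in unitmx by rewrite !unitmx_mul pencilmx_unit ?uS.
have ME : M = tens (fun=> invmx K *m invmx S *m K *m S).
  rewrite /M /A /As hA_tens // hAstar_tens //.
  have [//|_ ->] := @tens_unit R[i] X D (fun=> K).
  have [//|_ ->] := @tens_unit R[i] X D (fun=> S).
  by rewrite !tensM.
have [uW _] := @tens_unit R[i] X D (fun=> T *m S *m K) (fun=> uW1).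
have WM : tens (fun=> T *m S *m K) *m M =
  diag_mx (\row_i \prod_k (1 - #|X|%:R) ^ eigenexp i0 i1 (hcoord i k)) *m
    tens (fun=> T *m S *m K).
  rewrite ME tensM.
  pose d : 'rV[R[i]]_#|X| := \row_a (1 - #|X|%:R) ^ eigenexp i0 i1 a.
  transitivity (tens (fun=> diag_mx d *m (T *m S *m K))
    : 'M[R[i]]_#|hvertex X D|).
    (* [K] and [S] cancel against their inverses in turn, leaving [T *m K *m S], the left side of
       [pencilmxP]. *)
    by apply: eq_tens => k; rewrite -pencilmxP // !mulmxA mulmxK // mulmxK.
  rewrite -tensM tens_diag; congr (diag_mx _ *m _); apply/rowP=> i.
  by rewrite !mxE; apply: eq_bigr => k _; rewrite mxE.
have [diagM specM] := diagonalizable_spectrum uW WM.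
split=> // a; rewrite specM; split=> [[i ->]|[s s_range ->]].
  exists (\sum_k eigenexp i0 i1 (hcoord i k)); first exact: eigenexp_sum_range.
  by rewrite mxE prod_exprz.
have [b <-] := eigenexp_sum_surj i10 i20 i21 s_range.
exists (enum_rank ([ffun k => enum_val (b k)] : hvertex X D)).
rewrite mxE prod_exprz //; congr (_ ^ _); apply: eq_bigr => k _.
by rewrite hcoord_rank ffunE enum_valK.
Qed.
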